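(* Let $(f,e,\alpha) \in \mathcal{S}^-(\Delta_\xi, r)\setminus\mathcal{B}^-(\Delta_\xi, r)$ with $e_1 < e_2$, and set $m = \min f$. Then $m < e_1$, $\alpha_m > 0$ and $$w(\xi; f,(e_1,e_2),\alpha) = w\big(\xi; f,(m,e_2),\rho(m,e_1)\circ\alpha\big) - w\big(\xi; f,(m,e_1),\rho(m,e_2)\circ\alpha\big),$$ and both triplets on the right-hand side belong to $\mathcal{B}^-(\Delta_\xi, r)$.
   Context: $D \ge 1$ and $r \ge 1$ are integers and $\Delta_\xi$ is a non-degenerate $D$-simplex in $\mathbb{R}^D$ with vertex labels $0,\dots,D$, naturally ordered, and barycentric coordinates $\xi_0,\dots,\xi_D$ (affine functions with value $\delta_{ij}$ at the vertices). A face is identified with its label set $f\subseteq\{0,\dots,D\}$; $\dim f = |f|-1$, $\min f$ is the smallest label. For $\alpha\in\mathbb{N}_0^{D+1}$, $|\alpha| = \sum_i\alpha_i$, $\operatorname{supp}(\alpha) = \{i:\alpha_i>0\}$, $b(\xi;\alpha) = \prod_i\xi_i^{\alpha_i}$. Whitney forms: $\varphi(\xi;i,j) = \xi_i\,\mathrm{d}\xi_j - \xi_j\,\mathrm{d}\xi_i$. Shift operator: $\rho(i,j)\circ\alpha = \alpha - 1_i + 1_j$ with $1_i$ the $i$-th unit vector. $\mathcal{S}^-(\Delta_\xi, r)$ is the set of triplets $(f,e,\alpha)$ with $\dim f\ge 1$, $e = (e_1,e_2)$ an ordered pair of labels of $f$ with $e_1\neq e_2$, $|\alpha| = r-1$ and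 $\operatorname{supp}(\alpha)\cup\{e_1,e_2\} = f$; to each is associated the 1-form $w(\xi; f,e,\alpha) = b(\xi;\alpha)\,\varphi(\xi;e_1,e_2)$. A pair $(f,e)$ is anchored if $e_1<e_2$ and $e_1 = \min f$. $\mathcal{B}^-(\Delta_\xi, r)$ is the subset of triplets of $\mathcal{S}^-(\Delta_\xi, r)$ whose pair $(f,e)$ is anchored. *)

(* Defs.v *)
From HB Require Import structures.
From mathcomp Require Import all_boot all_order all_algebra.
From mathcomp Require Import all_classical all_reals all_analysis.

Set Implicit Arguments.
Unset Strict Implicit.
Unset Printing Implicit Defensive.

Import Order.TTheory GRing.Theory Num.Theory.
Import numFieldNormedType.Exports.

Local Open Scope classical_set_scope.
Local Open Scope ring_scope.

Section Simplex.
Variables (R : realType) (D : nat).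

(* The D edge vectors issued from vertex 0 are linearly independent. *)
Definition nondegenerate_simplex (v : 'I_D.+1 -> 'rV[R]_D) : bool :=
  row_free (\matrix_(i < D) (v (lift ord0 i) - v ord0)).

Definition affine (g : 'rV[R]_D -> R^o) : Prop :=
  exists (l : {linear 'rV[R]_D -> R^o}) (c : R), forall x, g x = l x + c.

Definition barycentric (v : 'I_D.+1 -> 'rV[R]_D)
    (xi : 'I_D.+1 -> 'rV[R]_D -> R^o) : Prop :=
  (forall i, affine (xi i)) /\ (forall i j, xi i (v j) = (i == j)%:R).

(* A 1-form sends a point and a tangent vector to a scalar; addition and
   opposite of 1-forms are the pointwise operations on functions. *)
Definition oneform : Type := 'rV[R]_D -> 'rV[R]_D -> R.

End Simplex.

Section Triplets.
Variable D : nat.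

Definition label : Type := 'I_D.+1.
Definition face : Type := {set 'I_D.+1}.
Definition multiindex : Type := {ffun 'I_D.+1 -> nat}.

Definition triplet : Type := (face * (label * label) * multiindex)%type.

(* dim set0 is 0 here instead of -1; only the condition 1 <= dim f is used. *)
Definition dim (f : face) : nat := #|f|.-1.

(* The default value ord0 is returned only when f is empty (see minlabelP). *)
Definition minlabel (f : face) : 'I_D.+1 :=
  [arg min_(i < ord0 in f) (i : nat)]%N.

Lemma minlabelP (f : face) : f != finset.set0 ->
  minlabel f \in f /\ (forall i : 'I_D.+1, i \in f -> (minlabel f <= i)%N).
Proof.
case/set0Pn => i0 fi0.
have -> : minlabel f = [arg min_(i < i0 in f) (i : nat)]%N.
  rewrite /minlabel /fintype.arg_min /fintype.extremum.
  case: pickP => //= /(_ [arg min_(i < i0 in f) (i : nat)]%N).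
  case: arg_minnP => // i fi mini /=.
  by rewrite fi /= => /forall_inP[].
by case: arg_minnP.
Qed.

Definition absm (a : multiindex) : nat := (\sum_i a i)%N.

Definition suppm (a : multiindex) : {set 'I_D.+1} := [set i | (0 < a i)%N]%SET.

(* rho i j a = a - 1_i + 1_j.  The subtraction is truncated, hence this is
   the actual shift only when a i > 0. *)
Definition rho (i j : 'I_D.+1) (a : multiindex) : multiindex :=
  [ffun k => (a k - (k == i) + (k == j))%N].

Definition anchored (f : face) (e : label * label) : Prop :=
  (e.1 < e.2)%N /\ e.1 = minlabel f.

Definition Sminus (r : nat) : set triplet :=
  [set t | let: (f, e, a) := t in
    [/\ (1 <= dim f)%N,
        [/\ e.1 \in f, e.2 \in f & e.1 != e.2],
        absm a = (r - 1)%N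
      & (suppm a :|: [set e.1; e.2] = f)%SET]].

Definition Bminus (r : nat) : set triplet :=
  [set t | Sminus r t /\ let: (f, e, a) := t in anchored f e].

End Triplets.

Arguments Sminus D r : clear implicits.
Arguments Bminus D r : clear implicits.

Section Forms.
Variables (R : realType) (D : nat) (xi : 'I_D.+1 -> 'rV[R]_D -> R^o).

Definition bernstein (a : multiindex D) (x : 'rV[R]_D) : R :=
  \prod_i xi i x ^+ a i.

Definition whitney (i j : 'I_D.+1) : oneform R D := fun x h =>
  xi i x * 'd (xi j) x h - xi j x * 'd (xi i) x h.

Definition wform (t : triplet D) : oneform R D :=
  let: (f, e, a) := t in fun x h => bernstein a x * whitney e.1 e.2 x h.

End Forms.

(* Main.v *)
(* The Whitney forms satisfy the three-term relation
   xi_m phi(i,j) = xi_i phi(m,j) - xi_j phi(m,i).  As m = min f is neither e1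
   nor e2, it lies in supp(alpha), so one factor xi_m can be taken out of
   b(xi; alpha) and exchanged by means of this relation. *)

Require Import Defs.
From HB Require Import structures.
From mathcomp Require Import all_boot all_order all_algebra.
From mathcomp Require Import all_classical all_reals all_analysis.
From mathcomp Require Import ring.

Set Implicit Arguments.
Unset Strict Implicit.
Unset Printing Implicit Defensive.

Import Order.TTheory GRing.Theory Num.Theory.
Import numFieldNormedType.Exports.

Local Open Scope classical_set_scope.
Local Open Scope ring_scope.

(** A shift is split into a removal and an addition. When [a i > 0], both [a] and its shifts
    [rho i j a], [rho i k a] then arise from the common multiindex [subm a i] by adding one
    label. *)
Definition addm (D : nat) (a : multiindex D) (i : 'I_D.+1) : multiindex D :=
  [ffun k => (a k + (k == i))%N].

Definition subm (D : nat) (a : multiindex D) (i : 'I_D.+1) : multiindex D :=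
  [ffun k => (a k - (k == i))%N].

Lemma rhoE (D : nat) (i j : 'I_D.+1) (a : multiindex D) :
  rho i j a = addm (subm a i) j.
Proof. by apply/ffunP => k; rewrite !ffunE. Qed.

Lemma submK (D : nat) (i : 'I_D.+1) (a : multiindex D) :
  (0 < a i)%N -> addm (subm a i) i = a.
Proof.
move=> ai; apply/ffunP => k; rewrite !ffunE.
by case: eqVneq => [->|_]; rewrite ?subnK // subn0 addn0.
Qed.

Lemma absm_addm (D : nat) (a : multiindex D) (i : 'I_D.+1) :
  absm (addm a i) = (absm a).+1.
Proof.
rewrite /absm; under eq_bigr do rewrite ffunE.
rewrite big_split /= [X in (_ + X)%N](bigD1 i) //= eqxx.
by rewrite [X in (_ + (_ + X))%N]big1 ?addn1 // => k /negPf ->.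
Qed.

Lemma absm_rho (D : nat) (i j : 'I_D.+1) (a : multiindex D) :
  (0 < a i)%N -> absm (rho i j a) = absm a.
Proof. by move=> ai; rewrite rhoE -[in RHS](submK ai) !absm_addm. Qed.

(** The shift can remove at most [i] from the support, and it adds [j]. The new pair restores [i],
    while on the right [i] is already in [suppm a]. Hence trading [j] for [i] in the pair keeps the
    face. *)
Lemma suppm_rhoU (D : nat) (i j k : 'I_D.+1) (a : multiindex D) :
  (0 < a i)%N ->
  (suppm (rho i j a) :|: [set i; k] = suppm a :|: [set j; k])%SET.
Proof.
move=> ai; apply/finset.setP => l; rewrite !inE ffunE addn_gt0 lt0b.
case: (eqVneq l i) => [->|_]; first by rewrite ai !orbT.
by rewrite subn0 orFb orbA.
Qed.

Lemma bernstein_addm (R : realType) (D : nat)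
    (xi : 'I_D.+1 -> 'rV[R]_D -> R^o) (a : multiindex D) (i : 'I_D.+1) x :
  bernstein xi (addm a i) x = xi i x * bernstein xi a x.
Proof.
rewrite /bernstein (bigD1 i) //= [in RHS](bigD1 i) //= ffunE eqxx addn1 exprS.
rewrite mulrA; congr (_ * _); apply: eq_bigr => k /negPf ki.
by rewrite ffunE ki addn0.
Qed.

(** On the right the two products of [xi j], [xi k] and the differential of [xi i] cancel; what
    remains has the common factor [xi i]. *)
Lemma whitney_cycle (R : realType) (D : nat)
    (xi : 'I_D.+1 -> 'rV[R]_D -> R^o) (i j k : 'I_D.+1) x h :
  xi i x * whitney xi j k x h =
  xi j x * whitney xi i k x h - xi k x * whitney xi i j x h.
Proof. rewrite /whitney; ring. Qed.

Lemma wform_rho (R : realType) (D : nat)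
    (xi : 'I_D.+1 -> 'rV[R]_D -> R^o) (f g : face D) (i j k : 'I_D.+1)
    (a : multiindex D) : (0 < a i)%N ->
  wform xi (f, (j, k), a) =
  (wform xi (g, (i, k), rho i j a) - wform xi (g, (i, j), rho i k a)
    :> ('rV[R]_D -> 'rV[R]_D -> R)).
Proof.
move=> ai; apply/funext => x; apply/funext => h; rewrite -[in LHS](submK ai).
(* All three terms now carry the factor [bernstein xi (subm a i) x]; [mulrAC] moves [xi i x] next to
   the Whitney form. *)
rewrite !fctE /= !rhoE !bernstein_addm mulrAC whitney_cycle; ring.
Qed.

(** The labels [j] and [k] are not assumed ordered, so that this serves both triplets of the
    decomposition. *)
Lemma Bminus_rho (D r : nat) (f : face D) (i j k : 'I_D.+1)
    (a : multiindex D) :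
  Sminus D r (f, (j, k), a) -> i = minlabel f -> (0 < a i)%N -> (i < k)%N ->
  Bminus D r (f, (i, k), rho i j a).
Proof.
move=> [df [jf kf _] aE fE] im ai ik.
split; last by [].
split=> //=.
- split=> //; first by rewrite -fE !inE ai.
  by rewrite -val_eqE /= ltn_eqF.
- by rewrite absm_rho.
- by rewrite suppm_rhoU.
Qed.

Lemma SminusC (D r : nat) (f : face D) (i j : 'I_D.+1) (a : multiindex D) :
  Sminus D r (f, (i, j), a) -> Sminus D r (f, (j, i), a).
Proof.
move=> [df [fi fj ij] aE fE]; split=> //=; first by split; rewrite // eq_sym.
by rewrite -fE [X in (_ :|: X)%SET]finset.setUC.
Qed.

Theorem theorem10 (R : realType) (D r : nat) (hD : (1 <= D)%N) (hr : (1 <= r)%N)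
    (v : 'I_D.+1 -> 'rV[R]_D) (hv : nondegenerate_simplex v)
    (xi : 'I_D.+1 -> 'rV[R]_D -> R^o) (hxi : barycentric v xi)
    (f : {set 'I_D.+1}) (e1 e2 : 'I_D.+1) (alpha : {ffun 'I_D.+1 -> nat})
    (hS : (Sminus D r `\` Bminus D r) (f, (e1, e2), alpha))
    (he : (e1 < e2)%N) :
  let m := minlabel f in
  [/\ (m < e1)%N,
      (0 < alpha m)%N,
      wform xi (f, (e1, e2), alpha) =
        (wform xi (f, (m, e2), rho m e1 alpha)
         - wform xi (f, (m, e1), rho m e2 alpha) :> ('rV[R]_D -> 'rV[R]_D -> R)),
      Bminus D r (f, (m, e2), rho m e1 alpha)
    & Bminus D r (f, (m, e1), rho m e2 alpha)].
Proof.
move=> m; case: hS => hS nB; have [_ [e1f e2f _] _ fE] := hS.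
have [mf mmin] : m \in f /\ forall i : 'I_D.+1, i \in f -> (m <= i)%N.
  by apply: minlabelP; apply/set0Pn; exists e1.
have me1 : (m < e1)%N.
  (* If [m = e1], then [e1 < e2] would make the pair anchored, against [nB]. *)
  rewrite ltn_neqAle mmin // andbT; apply/eqP => /val_inj m_e1.
  by apply: nB; split.
have me2 : (m < e2)%N := ltn_trans me1 he.
have am : (0 < alpha m)%N.
  by move: mf; rewrite -fE !inE -!val_eqE /= !ltn_eqF // !orbF.
split=> //; first exact: wform_rho.
- exact: Bminus_rho hS _ _ _.
(* Here [e2] is the label traded for [m], so the pair is first reversed. *)
- exact: Bminus_rho (SminusC hS) _ _ _.
Qed.
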